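(* Let $(R,B)$ be a fusion ring. Then $R$ is near-integral if and only if there exist a ring homomorphism $\chi:R\to\mathbb{C}$ and an element $\rho\in B$ such that $\chi(\rho)\neq\mathrm{FPdim}(\rho)$ and $\chi(x)=\mathrm{FPdim}(x)$ for all $x\in B$ with $x\neq\rho$.
   Context: A fusion ring $(R,B)$ is a unital associative ring $R$, free as a $\mathbb{Z}$-module with finite basis $B=\{1_R=b_1,\ldots,b_n\}$, such that $b_ib_j=\sum_k c_{ij}^kb_k$ with $c_{ij}^k\in\mathbb{Z}_{\geq0}$, together with an involution $\ast$ of $\{1,\ldots,n\}$ such that $\sum_ja_jb_j\mapsto\sum_ja_jb_{j^\ast}$ is an antiautomorphism of $R$ and $c_{ij}^1=1$ if $i=j^\ast$ and $0$ otherwise. $\mathrm{FPdim}:R\to\mathbb{C}$ is the ring homomorphism sending each $b_i\in B$ to the maximal real eigenvalue of the matrix $[c_{ij}^k]_{j,k}$. A fusion subring of $(R,B)$ is a fusion ring $(S,C)$ with $C\subseteq B$ and $S\subseteq R$ the $\mathbb{Z}$-span of $C$ (with the multiplication, unit and involution of $R$). The fusion ring $(R,B)$ is near-integral if it has a fusion subring $(S,C)$ with $|C|+1=|B|$. Ring homomorphisms are unital. *)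

(* Defs.v *)
From HB Require Import structures.
From mathcomp Require Import all_boot all_order all_algebra.
From mathcomp Require Import all_classical all_reals.
From mathcomp Require Import complex.

Set Implicit Arguments.
Unset Strict Implicit.
Unset Printing Implicit Defensive.

Import Order.TTheory GRing.Theory Num.Theory.

Local Open Scope ring_scope.

Definition antiautomorphism (R : pzRingType) (f : R -> R) : Prop :=
  [/\ bijective f, {morph f : x y / x + y}, f 1 = 1 &
      forall x y, f (x * y) = f y * f x].

(* [fusion_basis R] makes the ring [R] a fusion ring (R, B). The basis
   elements b_1, ..., b_n are indexed from 0, so that [fb_elt ord0] is the unit.
   [fb_coord] and the two cancellation laws say that they form a Z-basis. *)
Record fusion_basis (R : pzRingType) := FusionBasis {
  fb_pred_rank : nat;
  fb_elt : 'I_fb_pred_rank.+1 -> R;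
  fb_coord : R -> {ffun 'I_fb_pred_rank.+1 -> int};
  fb_coordK : forall x : R, \sum_j fb_elt j *~ fb_coord x j = x;
  fb_coord_sum : forall a : {ffun 'I_fb_pred_rank.+1 -> int},
    fb_coord (\sum_j fb_elt j *~ a j) = a;
  fb_elt1 : fb_elt ord0 = 1;
  (* [fb_mult i j k] is c_{ij}^k *)
  fb_mult : 'I_fb_pred_rank.+1 -> 'I_fb_pred_rank.+1 ->
            'I_fb_pred_rank.+1 -> nat;
  fb_multE : forall i j,
    fb_elt i * fb_elt j = \sum_k fb_elt k *+ fb_mult i j k;
  fb_dual : 'I_fb_pred_rank.+1 -> 'I_fb_pred_rank.+1;
  fb_dualK : involutive fb_dual;
  fb_dual_anti : antiautomorphism
    (fun x : R => \sum_j fb_elt (fb_dual j) *~ fb_coord x j);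
  fb_mult_unit : forall i j, fb_mult i j ord0 = (i == fb_dual j)
}.

Definition fb_index (R : pzRingType) (B : fusion_basis R) : finType :=
  'I_(fb_pred_rank B).+1.

Section FPdim.
Variables (K : realType) (R : pzRingType) (B : fusion_basis R).

Definition mult_matrix (i : fb_index B) : 'M[K]_((fb_pred_rank B).+1) :=
  \matrix_(j, k) (fb_mult i j k)%:R.

Definition is_max_eigenvalue (n : nat) (M : 'M[K]_n) (x : K) : Prop :=
  eigenvalue M x /\ forall y : K, eigenvalue M y -> y <= x.

(* The default value 0 is never used: a multiplication matrix is nonnegative,
   so it has a maximal real eigenvalue by the Perron-Frobenius theorem. *)
Definition FPdim_elt (i : fb_index B) : K :=
  xget 0 [set x : K | is_max_eigenvalue (mult_matrix i) x]%classic.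

Definition FPdim (x : R) : K[i] :=
  \sum_(i : fb_index B) (FPdim_elt i)%:C%C *~ fb_coord B x i.

End FPdim.

Section Subring.
Variables (R : pzRingType) (B : fusion_basis R).

Definition Zspan (C : {set fb_index B}) (x : R) : Prop :=
  exists a : fb_index B -> int, x = \sum_(i in C) fb_elt i *~ a i.

(* The Z-span of C, with the operations inherited from R, is a fusion ring with
   basis C; all the axioms that are not listed here are inherited from (R, B). *)
Definition fusion_subring (C : {set fb_index B}) : Prop :=
  [/\ (ord0 : fb_index B) \in C,
      forall x y, Zspan C x -> Zspan C y -> Zspan C (x * y) &
      forall i, i \in C -> (fb_dual i : fb_index B) \in C].

Definition near_integral : Prop :=
  exists C : {set fb_index B},
    fusion_subring C /\ (#|C| + 1)%N = #|fb_index B|.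

End Subring.

Arguments FPdim K {R} B x.

(* Main.v *)
Require Import Defs.
From HB Require Import structures.
From mathcomp Require Import all_boot all_order all_algebra.
From mathcomp Require Import all_classical all_reals.
From mathcomp Require Import complex.
From mathcomp Require Import topology normedtype derive.
From mathcomp Require Import ring lra.

(** Write c_ij^k for the structure constants and d for FPdim on the basis.
    The matrix of right multiplication by the sum of the basis is symmetric and
    positive, so it has a positive eigenvector, unique up to scaling (found by
    maximizing the Rayleigh quotient). Left multiplications commute with it,
    hence that eigenvector, normalized at the unit, is a positive character d;
    a positive common eigenvector can only belong to the maximal eigenvalues, so
    d is FPdim.

    If the span of B \ {rho} is a fusion subring, then b_i rho = d_i rho =
    rho b_i for every i <> rho, so with m = c_{rho rho}^rho the other root
    m - d_rho of the quadratic equation satisfied by d_rho defines a second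
    character agreeing with d away from rho.

    Conversely, comparing chi with d on b_i b_j gives c_ij^rho = 0 whenever
    i, j <> rho. If rho were not self-dual, rotating these coefficients would
    give rho^2 = m rho, hence chi(rho) = 0, whereas chi(rho rho^* ) >= 1. *)

Import Order.TTheory GRing.Theory Num.Theory.
Import numFieldNormedType.Exports.

Local Open Scope ring_scope.

(** * Symmetric positive matrices *)

Section Perron.
Variables (K : realType) (n : nat).
Implicit Types (A : 'M[K]_n) (x y : 'rV[K]_n).

Lemma quad_form_sum A x :
  (x *m A *m x^T) 0 0 = \sum_j (\sum_i x 0 i * A i j) * x 0 j.
Proof. by rewrite mxE; apply: eq_bigr => j _; rewrite !mxE. Qed.

Lemma sqr_norm_sum x : (x *m x^T) 0 0 = \sum_i x 0 i ^+ 2.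
Proof. by rewrite mxE; apply: eq_bigr => j _; rewrite !mxE expr2. Qed.

Lemma sqr_norm_ge0 x : 0 <= (x *m x^T) 0 0.
Proof. by rewrite sqr_norm_sum sumr_ge0 // => i _; rewrite sqr_ge0. Qed.

Lemma sqr_norm_eq0 x : (x *m x^T) 0 0 = 0 -> x = 0.
Proof.
rewrite sqr_norm_sum => /eqP.
rewrite psumr_eq0 => [/allP x0|i _]; last exact: sqr_ge0.
apply/rowP => i; rewrite mxE; apply/eqP; rewrite -sqrf_eq0.
by have := x0 i; rewrite mem_index_enum; exact.
Qed.

Lemma sum_continuous (T : topologicalType) m (f : 'I_m -> T -> K) :
  (forall i, continuous (f i)) -> continuous (fun t => \sum_i f i t).
Proof.
move=> fc; apply: (@continuous_big K 'I_m +%R 0 xpredT).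
  exact: add_continuous.
by move=> i _; exact: fc.
Qed.

Lemma quad_form_continuous A :
  continuous (fun x => (x *m A *m x^T) 0 0).
Proof.
have mulc (T : topologicalType) (f g : T -> K) :
    continuous f -> continuous g -> continuous (fun t => f t * g t).
  by move=> fc gc t; apply: cvgM; [exact: fc|exact: gc].
rewrite (funext (quad_form_sum A)); apply: sum_continuous => j.
apply: (mulc); last exact: coord_continuous.
apply: sum_continuous => i.
apply: mulc; first exact: coord_continuous.
exact: cst_continuous.
Qed.

Lemma sphere_compact : compact [set x : 'rV[K]_n | (x *m x^T) 0 0 = 1]%classic.
Proof.
apply: bounded_closed_compact.
  exists 1; split=> // M M1 x /= x1.
  apply: (le_trans _ (ltW M1)).
  rewrite [leLHS]/Num.norm /= mx_normrE; apply/bigmax_leP; split=> //= -[i j] _ /=.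
  rewrite ord1 -[leRHS]normr1 -ler_sqr ?nnegrE // !real_normK ?num_real //.
  by rewrite expr1n -x1 sqr_norm_sum (bigD1 j) //= lerDl sumr_ge0 // => k _; rewrite sqr_ge0.
rewrite (_ : mkset _ = (fun x => (x *m 1%:M *m x^T) 0 0) @^-1` [set 1])%classic; last first.
  by apply/seteqP; split=> x /=; rewrite mulmx1.
apply: closed_comp; last exact: closed_eq.
by move=> x _; exact: quad_form_continuous.
Qed.

Lemma quad_formZ A a x :
  (a *: x *m A *m (a *: x)^T) 0 0 = a ^+ 2 * (x *m A *m x^T) 0 0.
Proof. by rewrite linearZ /= -scalemxAr -!scalemxAl scalerA mxE expr2. Qed.

(** The form attains a maximum on the compact unit sphere; since both sides are homogeneous of
    degree two, the bound extends from there to every [y]. *)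
Lemma rayleigh_max A : (0 < n)%N ->
  exists2 x : 'rV[K]_n, (x *m x^T) 0 0 = 1 &
    forall y : 'rV[K]_n, (y *m A *m y^T) 0 0 <= (x *m A *m x^T) 0 0 * (y *m y^T) 0 0.
Proof.
move=> n0.
have S0 : ([set x : 'rV[K]_n | (x *m x^T) 0 0 = 1] !=set0)%classic.
  exists (delta_mx 0 (Ordinal n0)); rewrite /= sqr_norm_sum (bigD1 (Ordinal n0)) //=.
  rewrite mxE !eqxx expr1n big1 ?addr0 // => i /negPf i0.
  by rewrite mxE i0 andbF expr0n.
have [|x /set_mem /= x1 xmax] := @EVT_max_rV K n (fun x => (x *m A *m x^T) 0 0) _ S0 sphere_compact.
  exact/continuous_subspaceT/quad_form_continuous.
exists x => // y.
have [y0|y0] := eqVneq ((y *m y^T) 0 0) 0.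
  by rewrite y0 (sqr_norm_eq0 _ y0) !mul0mx mxE mulr0.
have yp : 0 < (y *m y^T) 0 0 by rewrite lt_def y0 sqr_norm_ge0.
set r := Num.sqrt ((y *m y^T) 0 0).
have r2 : r ^+ 2 = (y *m y^T) 0 0 by rewrite sqr_sqrtr // ltW.
have := xmax (r^-1 *: y); rewrite quad_formZ exprVn r2 => le1.
rewrite -ler_pdivrMr // mulrC; apply: le1; apply/mem_set => /=.
have := quad_formZ 1%:M r^-1 y; rewrite !mulmx1 => ->.
by rewrite exprVn r2 mulVf.
Qed.

(* First-order optimality: along [x + e h] with [h = x *m M], the form grows
   linearly at rate [2 |h|^2]. *)
Lemma nsd_isotropic_ker (M : 'M[K]_n) x : M^T = M ->
  (forall y, (y *m M *m y^T) 0 0 <= 0) -> (x *m M *m x^T) 0 0 = 0 -> x *m M = 0.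
Proof.
move=> Msym Mle x0; apply: sqr_norm_eq0; set h := x *m M.
have hT : M *m x^T = h^T by rewrite /h trmx_mul Msym.
set a := (h *m h^T) 0 0; set c := (h *m M *m h^T) 0 0.
have expand e : ((x + e *: h) *m M *m (x + e *: h)^T) 0 0 = 2 * e * a + e ^+ 2 * c.
  rewrite linearD /= linearZ /= !mulmxDl !mulmxDr -!scalemxAr -!scalemxAl.
  rewrite -[h *m M *m x^T]mulmxA hT -/h.
  have addE (X Y : 'M[K]_1) : (X + Y) 0 0 = X 0 0 + Y 0 0 by rewrite mxE.
  have scaleE t (X : 'M[K]_1) : (t *: X) 0 0 = t * X 0 0 by rewrite mxE.
  by rewrite !(addE, scaleE) x0 -/a -/c; ring.
have a0 : 0 <= a by exact: sqr_norm_ge0.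
apply/eqP; rewrite eq_le a0 andbT leNgt; apply/negP => ap.
(* The step is small enough for the linear gain to beat the quadratic term: the value becomes a
   square times [2 * (|c| + 1) + c], which is positive. *)
have := Mle (x + (a / (`|c| + 1)) *: h); rewrite expand.
have cp : 0 < `|c| + 1 by rewrite ltr_wpDl.
rewrite leNgt => /negP; apply.
have -> : 2 * (a / (`|c| + 1)) * a + (a / (`|c| + 1)) ^+ 2 * c =
  (a / (`|c| + 1)) ^+ 2 * (2 * (`|c| + 1) + c) by field; rewrite gt_eqF.
rewrite mulr_gt0 ?exprn_gt0 ?divr_gt0 //.
by have := ler_norm (- c); rewrite normrN; lra.
Qed.

(** Since [A] is positive, replacing a maximizer [x] by its entrywise absolute value [d] keeps the
    norm and cannot lower the form. So [d] is again a maximizer, isotropic for the negative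
    semidefinite [A - l%:M], hence in its kernel. *)
Lemma perron_symmetric A : (0 < n)%N -> A^T = A -> (forall i j, 0 < A i j) ->
  exists (d : 'I_n -> K) (l : K), (forall i, 0 < d i) /\
    forall i, \sum_j A i j * d j = l * d i.
Proof.
move=> n0 Asym Apos; have [x x1 xmax] := rayleigh_max A n0.
set l := (x *m A *m x^T) 0 0 in xmax.
pose d : 'rV[K]_n := \row_i `|x 0 i|.
have d1 : (d *m d^T) 0 0 = 1.
  rewrite -x1 !sqr_norm_sum; apply: eq_bigr => i _.
  by rewrite mxE real_normK ?num_real.
have dl : (d *m A *m d^T) 0 0 = l.
  apply/eqP; rewrite eq_le; apply/andP; split.
    by have := xmax d; rewrite d1 mulr1.
  rewrite /l !quad_form_sum; apply: ler_sum => j _; rewrite !mulr_suml.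
  apply: ler_sum => i _; rewrite !mxE (le_trans (ler_norm _)) // !normrM.
  by rewrite (gtr0_norm (Apos _ _)).
have quadB y : (y *m (A - l%:M) *m y^T) 0 0 =
    (y *m A *m y^T) 0 0 - l * (y *m y^T) 0 0.
  rewrite mulmxBr mulmxBl mxE [in X in _ + X]mxE mul_mx_scalar -scalemxAl.
  by rewrite [in X in - X]mxE.
have dA : d *m (A - l%:M) = 0.
  apply: nsd_isotropic_ker; first by rewrite linearB /= Asym tr_scalar_mx.
    by move=> y; rewrite quadB subr_le0.
  by rewrite quadB d1 dl mulr1 subrr.
have dE i : \sum_j A i j * d 0 j = l * d 0 i.
  move/eqP: dA; rewrite mulmxBr mul_mx_scalar subr_eq0 => /eqP /rowP /(_ i).
  rewrite mxE [RHS]mxE => <-.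
  by apply: eq_bigr => j _; rewrite mulrC -[in LHS]Asym [A^T _ _]mxE.
exists (fun i => d 0 i), l; split=> // i.
have d_ge0 j : 0 <= d 0 j by rewrite mxE.
(* A zero entry turns its row of the eigenvalue equation into a vanishing sum of nonnegative terms;
   this forces [d = 0], against norm one. *)
rewrite lt_def d_ge0 andbT; apply/eqP => di0.
have /eqP := dE i; rewrite di0 mulr0 psumr_eq0 => [/allP d0|j _]; last first.
  by rewrite mulr_ge0 // ltW.
have : (d *m d^T) 0 0 = 0.
  rewrite sqr_norm_sum big1 // => j _; apply/eqP; rewrite sqrf_eq0.
  by have := d0 j; rewrite mem_index_enum mulf_eq0 gt_eqF //=; exact.
by move/eqP; rewrite d1 oner_eq0.
Qed.

(** With [f i] the least ratio [w i / d i], the eigenvector [w - f i * d] is nonnegative and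
    vanishes at [i]. Row [i] of its eigenvalue equation, having positive coefficients, then makes it
    vanish everywhere. *)
Lemma perron_simple A (d w : 'I_n -> K) l : (0 < n)%N ->
  (forall i j, 0 < A i j) -> (forall i, 0 < d i) ->
  (forall i, \sum_j A i j * d j = l * d i) ->
  (forall i, \sum_j A i j * w j = l * w i) ->
  exists t, forall i, w i = t * d i.
Proof.
move=> n0 Apos dpos dE wE.
pose f i := w i / d i.
have [i _ fmin] := @Order.TotalTheory.arg_minP _ _ _ (Ordinal n0) xpredT f isT.
exists (f i) => j.
have ge0 k : 0 <= w k - f i * d k by rewrite subr_ge0 -ler_pdivlMr // fmin.
have : \sum_k A i k * (w k - f i * d k) = 0.
  under eq_bigr do rewrite mulrBr mulrCA.
  rewrite sumrB -mulr_sumr wE dE mulrCA -mulrBr /f divfK ?gt_eqF //.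
  by rewrite subrr mulr0.
move/eqP; rewrite psumr_eq0 => [/allP /(_ j)|k _]; last by rewrite mulr_ge0 // ltW.
by rewrite mem_index_enum mulf_eq0 gt_eqF //= subr_eq0 => /(_ isT) /eqP.
Qed.

End Perron.

(** * Structure constants of a fusion ring *)

Section FusionBasis.
Variables (R : pzRingType) (B : fusion_basis R).

Local Notation I := 'I_(fb_pred_rank B).+1.
Local Notation b := (@fb_elt R B).
Local Notation c := (@fb_mult R B).
Local Notation dual := (@fb_dual R B).

Lemma fb_coord_sumE (a : I -> int) j : fb_coord B (\sum_i b i *~ a i) j = a j.
Proof.
have -> : \sum_i b i *~ a i = \sum_i b i *~ [ffun k => a k] i.
  by apply: eq_bigr => i _; rewrite ffunE.
by rewrite fb_coord_sum ffunE.
Qed.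

Lemma fb_coordB x y j : fb_coord B (x - y) j = fb_coord B x j - fb_coord B y j.
Proof.
rewrite -{1}(fb_coordK B x) -{1}(fb_coordK B y) -sumrB.
by under eq_bigr do rewrite -mulrzBr; rewrite fb_coord_sumE.
Qed.

Lemma fb_coord_elt i j : fb_coord B (b i) j = (j == i)%:R.
Proof.
have {1}-> : b i = \sum_k b k *~ (k == i)%:R.
  by rewrite (bigD1 i) //= eqxx mulr1z big1 ?addr0 // => k /negPf ->; rewrite mulr0z.
exact: fb_coord_sumE.
Qed.

Lemma fb_coord_mul i j k : fb_coord B (b i * b j) k = c i j k :> int.
Proof. by rewrite fb_multE -(fb_coord_sumE (fun k => c i j k)). Qed.

Lemma fb_mult1l j k : c ord0 j k = (k == j).
Proof.
by apply/eqP; rewrite -eqz_nat -fb_coord_mul fb_elt1 mul1r fb_coord_elt; case: (k == j).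
Qed.

Lemma fb_mult1r i k : c i ord0 k = (k == i).
Proof.
by apply/eqP; rewrite -eqz_nat -fb_coord_mul fb_elt1 mulr1 fb_coord_elt; case: (k == i).
Qed.

Lemma fb_multA i j k l :
  (\sum_m c i j m * c m k l = \sum_m c j k m * c i m l)%N.
Proof.
have L : b i * b j * b k = \sum_l b l *~ Posz (\sum_m c i j m * c m k l)%N.
  rewrite fb_multE mulr_suml.
  under eq_bigr => m _ do rewrite mulrnAl fb_multE -sumrMnl.
  rewrite exchange_big /=; apply: eq_bigr => m _.
  rewrite -pmulrn -sumrMnr; apply: eq_bigr => p _.
  by rewrite -mulrnA mulnC.
have {L}: b i * (b j * b k) = \sum_l b l *~ Posz (\sum_m c i j m * c m k l)%N.
  by rewrite mulrA.
have -> : b i * (b j * b k) = \sum_l b l *~ Posz (\sum_m c j k m * c i m l)%N.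
  rewrite [in LHS]fb_multE mulr_sumr.
  under eq_bigr => m _ do rewrite mulrnAr fb_multE -sumrMnl.
  rewrite exchange_big /=; apply: eq_bigr => m _.
  rewrite -pmulrn -sumrMnr; apply: eq_bigr => p _.
  by rewrite -mulrnA mulnC.
move/(congr1 (fun x => fb_coord B x l)).
rewrite (fb_coord_sumE (fun l => Posz (\sum_m c j k m * c i m l)%N)).
by rewrite (fb_coord_sumE (fun l => Posz (\sum_m c i j m * c m k l)%N)) => -[].
Qed.

Lemma fb_dual_eq i j : (dual i == j) = (i == dual j).
Proof. by rewrite -(inj_eq (inv_inj (@fb_dualK _ B))) fb_dualK. Qed.

(* Both sides are the coefficient of the unit in [b i * b j * b k]. *)
Lemma fb_mult_rot i j k : c i j (dual k) = c j k (dual i).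
Proof.
have := fb_multA i j k ord0.
rewrite (bigD1 (dual k)) //= fb_mult_unit eqxx muln1 big1 ?addn0; last first.
  by move=> m /negPf mk; rewrite fb_mult_unit mk muln0.
rewrite (bigD1 (dual i)) //= fb_mult_unit fb_dualK eqxx muln1 big1 ?addn0 //.
by move=> m /negPf mi; rewrite fb_mult_unit -fb_dual_eq eq_sym mi muln0.
Qed.

Lemma fb_mult_dual i j k : c i j k = c (dual j) (dual i) (dual k).
Proof.
have [_ _ _ starM] := fb_dual_anti B.
have star_elt p : \sum_q b (dual q) *~ fb_coord B (b p) q = b (dual p).
  rewrite (bigD1 p) //= fb_coord_elt eqxx mulr1z big1 ?addr0 // => q /negPf qp.
  by rewrite fb_coord_elt qp mulr0z.
have := starM (b i) (b j); rewrite !star_elt.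
move/(congr1 (fun x => fb_coord B x (dual k))); rewrite fb_coord_mul.
rewrite (reindex_inj (inv_inj (@fb_dualK _ B))) /=.
under eq_bigr do rewrite fb_dualK.
rewrite (fb_coord_sumE (fun q => fb_coord B (b i * b j) (dual q))) fb_dualK.
by rewrite fb_coord_mul => -[].
Qed.

(** Right multiplication by the dual element is the transpose, so summing over [l] gives a symmetric
    matrix. *)
Lemma fb_mult_sym j l k : c j l k = c k (dual l) j.
Proof.
by rewrite -{1}(fb_dualK k) fb_mult_rot fb_mult_dual !fb_dualK.
Qed.

(** Otherwise rotation gives [b (dual k) * b j = 0], whereas [b k * b (dual k) * b j] contains [b j]
    because [b k * b (dual k)] contains the unit. *)
Lemma fb_mult_sum_gt0 j k : (0 < \sum_l c j l k)%N.
Proof.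
have rot l : c j l k = c (dual k) j (dual l).
  by rewrite -{1}[k]fb_dualK fb_mult_rot fb_mult_rot.
under eq_bigr do rewrite rot.
rewrite lt0n; apply/negP; rewrite sum_nat_eq0 => /forallP cE.
have c0 m : c (dual k) j m = 0%N by have /eqP := cE (dual m); rewrite fb_dualK.
have := fb_multA k (dual k) j j; rewrite [in RHS]big1 => [|m _]; last by rewrite c0.
rewrite (bigD1 ord0) //= fb_mult_unit fb_mult1l !fb_dualK !eqxx.
by [].
Qed.

(** * Additive extension of maps from the basis *)

Section Lift.
Variables (S : pzRingType) (f : I -> S).

Definition fb_lift (x : R) : S := \sum_i f i *~ fb_coord B x i.

Lemma fb_lift_additive : zmod_morphism fb_lift.
Proof.
by move=> x y; rewrite /fb_lift -sumrB; apply: eq_bigr => i _; rewrite fb_coordB mulrzBr.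
Qed.

HB.instance Definition _ :=
  GRing.isZmodMorphism.Build R S fb_lift fb_lift_additive.

Lemma fb_lift_elt i : fb_lift (b i) = f i.
Proof.
rewrite /fb_lift (bigD1 i) //= fb_coord_elt eqxx mulr1z big1 ?addr0 // => j /negPf ji.
by rewrite fb_coord_elt ji mulr0z.
Qed.

Lemma fb_lift_rmorphism : f ord0 = 1 ->
  (forall i j, f i * f j = \sum_k f k *+ c i j k) ->
  exists chi : {rmorphism R -> S}, forall i, chi (b i) = f i.
Proof.
move=> f1 fM.
have liftM : monoid_morphism fb_lift.
  split=> [|x y]; first by rewrite -(fb_elt1 B) fb_lift_elt.
  rewrite -{1}(fb_coordK B x) -{1}(fb_coordK B y) mulr_suml raddf_sum.
  rewrite [X in _ = X * _]/fb_lift mulr_suml; apply: eq_bigr => i _.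
  rewrite mulr_sumr raddf_sum mulr_sumr; apply: eq_bigr => j _ /=.
  rewrite !(mulrzAl, mulrzAr) !raddfMz fb_multE fM raddf_sum.
  congr (_ *~ _ *~ _); apply: eq_bigr => k _.
  by rewrite raddfMn /= fb_lift_elt.
pose chi : {rmorphism R -> S} := HB.pack fb_lift
  (GRing.isMonoidMorphism.Build _ _ _ liftM).
by exists chi => i; exact: fb_lift_elt.
Qed.

End Lift.

End FusionBasis.

(** * Frobenius-Perron dimension *)

Section FPdimension.
Variables (K : realType) (R : pzRingType) (B : fusion_basis R).

Local Notation I := 'I_(fb_pred_rank B).+1.
Local Notation b := (@fb_elt R B).
Local Notation c := (@fb_mult R B).
Local Notation dual := (@fb_dual R B).

(* The Perron eigenvector of right multiplication by the sum of the basis is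
   unique up to scaling, and left multiplications commute with it. *)
Lemma positive_character : exists d : I -> K,
  [/\ forall i, 0 < d i, d ord0 = 1 &
      forall i j, d i * d j = \sum_k (c i j k)%:R * d k].
Proof.
pose A : 'M[K]_((fb_pred_rank B).+1) := \matrix_(j, k) (\sum_l c j l k)%:R.
have Apos i j : 0 < A i j by rewrite mxE ltr0n fb_mult_sum_gt0.
have Asym : A^T = A.
  apply/matrixP => i j; rewrite !mxE; congr _%:R.
  rewrite (reindex_inj (inv_inj (@fb_dualK _ B))); apply: eq_bigr => l _.
  by rewrite -fb_mult_sym.
have [d [l [dpos dE]]] := perron_symmetric _ _ A isT Asym Apos.
have mulE i j : \sum_k (c i j k)%:R * d k = d i / d ord0 * d j.
  pose w j := \sum_k (c i j k)%:R * d k.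
  have wE p : \sum_q A p q * w q = l * w p.
    have -> : l * w p = \sum_k (c i p k)%:R * \sum_m A k m * d m.
      by rewrite mulr_sumr; apply: eq_bigr => k _; rewrite dE mulrCA.
    under eq_bigr do rewrite mulr_sumr.
    under [in RHS]eq_bigr do rewrite mulr_sumr.
    rewrite exchange_big [in RHS]exchange_big; apply: eq_bigr => m _ /=.
    under eq_bigr do rewrite mulrA.
    under [in RHS]eq_bigr do rewrite mulrA.
    rewrite -!mulr_suml; congr (_ * _).
    under eq_bigr do rewrite mxE -natrM.
    under [in RHS]eq_bigr do rewrite mxE -natrM.
    rewrite -!natr_sum; congr _%:R.
    under eq_bigr do rewrite big_distrl.
    under [in RHS]eq_bigr do rewrite big_distrr.
    rewrite exchange_big [in RHS]exchange_big; apply: eq_bigr => q _ /=.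
    by rewrite fb_multA.
  have [t tE] := perron_simple _ _ A d w l isT Apos dpos dE wE.
  rewrite -[LHS]/(w j) tE; congr (_ * _).
  (* The factor [t] is found by evaluating [w] at the unit, where it equals [d i]. *)
  apply: (canRL (mulfK _)); first by rewrite gt_eqF.
  rewrite -tE /w (bigD1 i) //= fb_mult1r eqxx mul1r big1 ?addr0 // => k /negPf ki.
  by rewrite fb_mult1r ki mul0r.
exists (fun i => d i / d ord0); split=> [i||i j]; first by rewrite divr_gt0.
  by rewrite divff ?gt_eqF.
rewrite mulrA -mulE mulr_suml; apply: eq_bigr => k _.
by rewrite mulrA.
Qed.

(** The character [d] is a positive column eigenvector of [mult_matrix K i] with eigenvalue [d i].
    Pairing it with the absolute values of a row eigenvector for [y] bounds [|y|] by [d i]. *)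
Lemma FPdim_elt_character (d : I -> K) : (forall i, 0 < d i) ->
  (forall i j, d i * d j = \sum_k (c i j k)%:R * d k) ->
  forall i, FPdim_elt K i = d i.
Proof.
move=> dpos dM i.
have dmax : is_max_eigenvalue (mult_matrix K i) (d i).
  split=> [|y /eigenvalueP [v vE v0]].
    (* [eigenvalue] asks for a row eigenvector; rotating the structure constants shows that
       dualizing the indices of [d] gives one. *)
    apply/eigenvalueP; exists (\row_j d (dual j)); last first.
      by apply/eqP => /rowP /(_ ord0) /eqP; rewrite !mxE gt_eqF.
    apply/rowP => k; rewrite !mxE mulrC dM.
    rewrite [RHS](reindex_inj (inv_inj (@fb_dualK _ B))); apply: eq_bigr => j _.
    rewrite !mxE mulrC; congr (_%:R * _).
    by rewrite -{1}[k]fb_dualK fb_mult_rot fb_mult_rot.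
  have s0 : 0 < \sum_j `|v 0 j| * d j.
    have [j vj] : exists j, v 0 j != 0 by apply/rV0Pn.
    rewrite (bigD1 j) //= ltr_pwDl ?mulr_gt0 ?normr_gt0 //.
    by rewrite sumr_ge0 // => k _; rewrite mulr_ge0 // ltW.
  apply: (le_trans (ler_norm y)); rewrite -(ler_pM2r s0) mulr_sumr.
  have -> : d i * (\sum_j `|v 0 j| * d j) =
      \sum_k (\sum_j `|v 0 j| * (c i j k)%:R) * d k.
    rewrite mulr_sumr; under eq_bigr do rewrite mulrCA dM mulr_sumr.
    rewrite exchange_big; apply: eq_bigr => k _ /=.
    by rewrite mulr_suml; apply: eq_bigr => j _; rewrite mulrA.
  apply: ler_sum => k _; rewrite mulrA ler_pM2r // -normrM.
  move/rowP: vE => /(_ k); rewrite [RHS]mxE => <-; rewrite mxE.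
  apply: (le_trans (ler_norm_sum _ _ _)); apply: ler_sum => j _.
  by rewrite normrM mxE normr_nat.
rewrite /FPdim_elt; case: xgetP => [y _ [ye ymax]|/(_ (d i))]; last by [].
by apply/eqP; rewrite eq_le dmax.2 // ymax //; case: dmax.
Qed.

Lemma FPdim_fb_elt i : FPdim K B (b i) = (FPdim_elt K i)%:C%C.
Proof. exact: (fb_lift_elt R B _ (fun i => (FPdim_elt K i)%:C%C)). Qed.

End FPdimension.

(** * Near-integral fusion rings *)

Section NearIntegral.
Variables (R : pzRingType) (B : fusion_basis R).

Local Notation I := 'I_(fb_pred_rank B).+1.
Local Notation b := (@fb_elt R B).
Local Notation c := (@fb_mult R B).
Local Notation dual := (@fb_dual R B).

(** Presents a coordinate as an additive map, to which the [raddf] lemmas apply. *)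
Lemma fb_coord_lift x k : fb_coord B x k = fb_lift R B int (fun m => (m == k)%:R) x.
Proof.
rewrite /fb_lift (bigD1 k) //= eqxx intz big1 ?addr0 // => m /negPf ->.
by rewrite mul0rz.
Qed.

Lemma fb_coordM x y k :
  fb_coord B (x * y) k =
    \sum_i \sum_j (c i j k)%:R *~ fb_coord B y j *~ fb_coord B x i.
Proof.
rewrite fb_coord_lift -{1}(fb_coordK B x) -{1}(fb_coordK B y) mulr_suml raddf_sum.
apply: eq_bigr => i _; rewrite mulr_sumr raddf_sum; apply: eq_bigr => j _ /=.
rewrite !(mulrzAl, mulrzAr) !raddfMz /= -fb_coord_lift fb_coord_mul.
by rewrite -natz.
Qed.

Lemma ZspanP (C : {set fb_index B}) x :
  Zspan C x <-> forall k, k \notin C -> fb_coord B x k = 0.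
Proof.
split=> [[a ->] k /negPf kC|x0].
  have -> : \sum_(i in C) b i *~ a i = \sum_i b i *~ (if i \in C then a i else 0).
    by rewrite big_mkcond; apply: eq_bigr => i _; case: ifP.
  by rewrite (fb_coord_sumE R B (fun i => if i \in C then a i else 0)) kC.
exists (fb_coord B x); rewrite -{1}(fb_coordK B x) [RHS]big_mkcond /=.
by apply: eq_bigr => i _; case: ifPn => // /x0 ->; rewrite mulr0z.
Qed.

(** The set [C] is the complement of a single [rho], and the three closure conditions of a fusion
    subring translate one by one; closure under products is tested on basis elements. *)
Lemma near_integralP : near_integral B <-> exists rho : I,
  [/\ rho != ord0, dual rho = rho &
      forall i j, i != rho -> j != rho -> c i j rho = 0%N].
Proof.
split=> [[C [[C0 CM Cdual] cardC]]|[rho [rho0 rhodual crho]]].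
  have /cards1P [rho Crho] : #|~: C| == 1%N.
    by rewrite -(eqn_add2l #|C|) cardsC cardC.
  have inC (i : fb_index B) : (i \in C) = (i != rho).
    by have := finset.in_setC i C; rewrite Crho inE => ->; rewrite negbK.
  exists rho; split=> [||i j iC jC]; first by rewrite eq_sym -inC.
    apply/eqP; apply: contraT; rewrite -inC => /Cdual.
    by rewrite fb_dualK inC eqxx.
  have elt_span k : k != rho -> Zspan C (b k).
    rewrite -inC => kC; apply/ZspanP => m mC; rewrite fb_coord_elt.
    by case: eqP => // mk; rewrite mk kC in mC.
  have /ZspanP /(_ rho) := CM _ _ (elt_span _ iC) (elt_span _ jC).
  by rewrite inC eqxx fb_coord_mul => /(_ isT) [].
exists [set~ rho]; split; last first.
  by rewrite addn1 cardsC1 prednK //; apply/card_gt0P; exists rho.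
split=> [|x y /ZspanP xC /ZspanP yC|i]; first by rewrite !inE eq_sym.
  apply/ZspanP => k; rewrite !inE negbK => /eqP ->.
  rewrite fb_coordM big1 // => i _; rewrite big1 // => j _.
  have [->|iC] := eqVneq i rho; first by rewrite xC ?mulr0z // !inE eqxx.
  have [->|jC] := eqVneq j rho; first by rewrite yC ?mulr0z ?mul0rz // !inE eqxx.
  by rewrite crho // !mul0rz.
by rewrite !inE fb_dual_eq rhodual.
Qed.

End NearIntegral.

(** * Characters agreeing with FPdim away from one basis element *)

Section Criterion.
Variables (K : realType) (R : pzRingType) (B : fusion_basis R).

Local Notation I := 'I_(fb_pred_rank B).+1.
Local Notation b := (@fb_elt R B).
Local Notation c := (@fb_mult R B).
Local Notation dual := (@fb_dual R B).

Variables (d : I -> K) (rho : I).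
Hypotheses (dpos : forall i, 0 < d i) (d1 : d ord0 = 1)
  (dM : forall i j, d i * d j = \sum_k (c i j k)%:R * d k).

Lemma near_integral_character :
  rho != ord0 -> dual rho = rho ->
  (forall i j, i != rho -> j != rho -> c i j rho = 0%N) ->
  exists chi : {rmorphism R -> K[i]},
    chi (b rho) != (d rho)%:C%C /\ forall i, i != rho -> chi (b i) = (d i)%:C%C.
Proof.
move=> rho0 rhodual crho.
have dual_rho k : k != rho -> dual k != rho by rewrite fb_dual_eq rhodual.
(* Rotating the vanishing coefficients leaves only multiples of [rho] in [b i * b rho] and
   [b rho * b i]. *)
have c_right i k : i != rho -> k != rho -> c i rho k = 0%N.
  move=> ir kr; rewrite -[k]fb_dualK fb_mult_rot fb_mult_rot rhodual.
  by rewrite crho // dual_rho.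
have c_left i k : i != rho -> k != rho -> c rho i k = 0%N.
  by move=> ir kr; rewrite -[k]fb_dualK fb_mult_rot rhodual crho // dual_rho.
have absorb i j : (forall k, k != rho -> c i j k = 0%N) ->
    d i * d j = (c i j rho)%:R * d rho.
  by move=> c0; rewrite dM (bigD1 rho) //= big1 ?addr0 // => k /c0 ->; rewrite mul0r.
have dr0 : d rho != 0 by rewrite gt_eqF.
have rightE i : i != rho -> (c i rho rho)%:R = d i.
  by move=> ir; apply: (mulIf dr0); rewrite -absorb // => k; exact: c_right.
have leftE i : i != rho -> (c rho i rho)%:R = d i.
  move=> ir; apply: (mulIf dr0); rewrite -absorb => [|k]; last exact: c_left.
  exact: mulrC.
pose m : K := (c rho rho rho)%:R.
(* The difference of the two roots [d rho] and [m - d rho], so that [e rho = m - d rho]. *)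
pose t := 2 * d rho - m.
pose e k : K := d k - (k == rho)%:R * t.
have e_out i : i != rho -> e i = d i.
  by move=> /negPf ir; rewrite /e ir mul0r subr0.
have eM i j : e i * e j = \sum_k e k *+ c i j k.
  have -> : \sum_k e k *+ c i j k = d i * d j - (c i j rho)%:R * t.
    rewrite dM; under eq_bigr do rewrite -mulr_natl mulrBr.
    rewrite sumrB; congr (_ - _); rewrite (bigD1 rho) //= eqxx mul1r.
    by rewrite big1 ?addr0 // => k /negPf ->; rewrite mul0r mulr0.
  have [->|ir] := eqVneq i rho; have [->|jr] := eqVneq j rho.
  - by rewrite -/m /e eqxx mul1r /t; ring.
  - by rewrite leftE // (e_out j) // /e eqxx mul1r; ring.
  - by rewrite rightE // (e_out i) // /e eqxx mul1r; ring.
  - by rewrite crho // !e_out //; ring.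
have [||chi chiE] := fb_lift_rmorphism R B K[i] (fun i => (e i)%:C%C).
- by rewrite e_out ?d1 // eq_sym.
- move=> i j; rewrite -rmorphM eM rmorph_sum; apply: eq_bigr => k _.
  by rewrite rmorphMn.
exists chi; split=> [|i ir]; last by rewrite chiE e_out.
rewrite chiE (inj_eq (@complexI K)) /e eqxx mul1r.
(* The unit occurs in the square of the self-dual [b rho], so [d rho ^+ 2] exceeds [m * d rho];
   hence [t] is nonzero. *)
have lt_m : m < d rho.
  rewrite -(ltr_pM2r (dpos rho)) (dM rho rho) (bigD1 rho) //= ltrDl.
  rewrite (bigD1 ord0) 1?eq_sym //= fb_mult_unit rhodual eqxx d1 mulr1.
  by rewrite ltr_pwDl // sumr_ge0 // => k _; rewrite mulr_ge0 // ltW.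
by apply/eqP; rewrite /t; have := dpos rho; lra.
Qed.

Lemma character_near_integral (chi : {rmorphism R -> K[i]}) :
  chi (b rho) != (d rho)%:C%C -> (forall i, i != rho -> chi (b i) = (d i)%:C%C) ->
  near_integral B.
Proof.
move=> chir chiE; apply/near_integralP; exists rho.
have rho0 : rho != ord0.
  by apply: contra_neq chir => ->; rewrite fb_elt1 rmorph1 d1.
have chiM i j : chi (b i) * chi (b j) = \sum_k chi (b k) *+ c i j k.
  by rewrite -rmorphM fb_multE rmorph_sum; apply: eq_bigr => k _; rewrite rmorphMn.
have crho i j : i != rho -> j != rho -> c i j rho = 0%N.
  move=> ir jr; have := chiM i j; rewrite !chiE // -rmorphM dM rmorph_sum.
  rewrite (bigD1 rho) //= [RHS](bigD1 rho) //=.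
  have -> : \sum_(k < _ | k != rho) ((c i j k)%:R * d k)%:C%C =
      \sum_(k < _ | k != rho) chi (b k) *+ c i j k.
    by apply: eq_bigr => k kr; rewrite chiE // mulr_natl rmorphMn.
  (* After cancelling the common terms, [c i j rho] times the nonzero difference of [d rho] and
     [chi (b rho)] is zero. *)
  move/addIr; rewrite mulr_natl rmorphMn /= => /eqP.
  rewrite -subr_eq0 -mulrnBl mulrn_eq0 subr_eq0 [_ == chi _]eq_sym (negPf chir) orbF.
  by move/eqP.
split=> //; apply/eqP; apply: contraT => dualr.
have rr k : k != rho -> c rho rho k = 0%N.
  move=> kr; rewrite -[k]fb_dualK fb_mult_rot fb_mult_dual !fb_dualK.
  by rewrite crho.
have chi_sq := chiM rho rho.
rewrite (bigD1 rho) //= big1 ?addr0 in chi_sq; last by move=> k /rr ->.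
have d_sq := dM rho rho.
rewrite (bigD1 rho) //= big1 ?addr0 in d_sq; last by move=> k /rr ->; rewrite mul0r.
(* As the square of [b rho] is a multiple of [b rho], both characters take on it either zero or that
   multiple; [d rho] is positive, so [chi] must give zero. *)
have mE : (c rho rho rho)%:R = d rho by apply/esym/(mulIf _ d_sq); rewrite gt_eqF.
have chi0 : chi (b rho) = 0.
  have : chi (b rho) * (chi (b rho) - (d rho)%:C%C) = 0.
    by rewrite mulrBr chi_sq -mE rmorph_nat mulr_natr subrr.
  by move/eqP; rewrite mulf_eq0 subr_eq0 (negPf chir) orbF => /eqP.
(* The left side is now zero, but on the right the unit contributes 1 and all other terms are
   nonnegative. *)
have := chiM rho (dual rho); rewrite chi0 mul0r (bigD1 rho) //= chi0 mul0rn add0r.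
have -> : \sum_(k < _ | k != rho) chi (b k) *+ c rho (dual rho) k =
    (\sum_(k < _ | k != rho) d k *+ c rho (dual rho) k)%:C%C.
  by rewrite rmorph_sum; apply: eq_bigr => k kr; rewrite chiE // rmorphMn.
move/esym/eqP; rewrite fmorph_eq0 gt_eqF //.
rewrite (bigD1 ord0) 1?eq_sym //= fb_mult_unit fb_dualK eqxx d1.
by rewrite ltr_pwDl // sumr_ge0 // => k _; rewrite mulrn_wge0 // ltW.
Qed.

End Criterion.

Theorem theorem3p6 (K : realType) (R : pzRingType) (B : fusion_basis R) :
  near_integral B <->
  exists (chi : {rmorphism R -> K[i]}) (rho : fb_index B),
    chi (fb_elt rho) <> FPdim K B (fb_elt rho) /\
    (forall i : fb_index B, i <> rho ->
       chi (fb_elt i) = FPdim K B (fb_elt i)).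
Proof.
have [d [dpos d1 dM]] := positive_character K R B.
have FPdimE i : FPdim K B (fb_elt i) = (d i)%:C%C.
  by rewrite FPdim_fb_elt (FPdim_elt_character K R B d).
split=> [/near_integralP [rho [rho0 rhodual crho]]|[chi [rho [chir chiE]]]].
  have [chi [chir chiE]] :=
    near_integral_character K R B d rho dpos d1 dM rho0 rhodual crho.
  exists chi, rho; split=> [|i /eqP ir]; rewrite FPdimE; first exact/eqP.
  exact: chiE.
apply: (character_near_integral K R B d rho dpos d1 dM chi).
  by apply/eqP; rewrite -FPdimE.
by move=> i /eqP ir; rewrite chiE.
Qed.
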